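(* Let $\Omega$ be a complete Reinhardt domain in $\mathbb{C}^n$ and let $\lambda\geq1$. If $\mathcal{O}(\Omega,X)$ is a space of holomorphic mappings on $\Omega$ into a complex Banach space $X$ that contains all $X$-valued polynomials, then for all $1\leq p,q<\infty$, $$A_{p,q}(\mathcal{O}(\Omega,X),\lambda)=A_{p,q}(H_\infty(\Omega,X),\lambda).$$
   Context: A complete Reinhardt domain $\Omega\subset\mathbb{C}^n$ is a domain such that $z\in\Omega$ implies $(\eta_1e^{i\theta_1}z_1,\dots,\eta_ne^{i\theta_n}z_n)\in\Omega$ for all $\eta_i\in[0,1]$, $\theta_i\in\mathbb{R}$. $X$-valued polynomials are finite sums $\sum_\alpha x_\alpha z^\alpha$ with $x_\alpha\in X$, regarded as maps on $\Omega$. $H_\infty(\Omega,X)$ is the set of bounded holomorphic maps $\Omega\to X$. A holomorphic $f:\Omega\to X$ is written $f(z)=\sum_{\alpha\in\mathbb{N}_0^n}x_\alpha(f)z^\alpha$, where $\mathbb{N}_0=\mathbb{N}\cup\{0\}$, with $x_0(f)=f(0)$, and $\|f\|_\Omega=\sup_{z\in\Omega}\|f(z)\|\in[0,\infty]$. For a set $\mathcal{F}$ of holomorphic maps $\Omega\to X$, the $\lambda_{p,q}$-arithmetic Bohr radius $A_{p,q}(\mathcal{F},\lambda)$ is the supremum of $\frac1n\sum_{i=1}^n r_i$ over all $r=(r_1,\dots,r_n)\in\mathbb{R}^n$ with all $r_i\geq0$ such that $$\|x_0(f)\|^p+\left(\sum_{m=1}^\infty\sum_{|\alpha|=m}\|x_\alpha(f)\|r^\alpha\right)^q\leq\lambda\|f\|_\Omega$$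 for all $f\in\mathcal{F}$. *)

(* Defs.v *)
From HB Require Import structures.
From mathcomp Require Import all_boot all_order all_algebra.
From mathcomp Require Import finmap.
From mathcomp Require Import all_classical all_reals all_analysis.
From mathcomp Require Import complex.
From mathcomp Require summability.

Set Implicit Arguments.
Unset Strict Implicit.
Unset Printing Implicit Defensive.

Import Order.TTheory GRing.Theory Num.Theory numFieldNormedType.Exports.

Local Open Scope classical_set_scope.
Local Open Scope ring_scope.

(* The complex numbers over R, bundled as a numFieldType so that the topology
   and the norm that every numFieldType carries are found on C R and on
   'rV[C R]_n (they are not inferred on the bare type R[i]). *)
Definition C (R : realType) : numFieldType := R[i].

Section Defs.
Variables (R : realType) (n : nat) (X : completeNormedModType (C R)).
Implicit Types (D : set 'rV[C R]_n) (f : 'rV[C R]_n -> X).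

(* The norm of X takes its values in the nonnegative reals of C R. *)
Definition rnorm (v : X) : R := complex.Re (`|v| : R[i]).

Definition expi (t : R) : C R := Complex (cos t) (sin t).

Definition domain D : Prop := [/\ D !=set0, open D & connected D].

Definition complete_Reinhardt D : Prop :=
  domain D /\
  forall z, D z -> forall eta theta : 'I_n -> R,
    (forall i, 0 <= eta i <= 1) ->
    D (\row_i ((real_complex R (eta i) : C R) * expi (theta i) * z ord0 i)).

Definition multiindex : choiceType := {ffun 'I_n -> nat}.

Definition mdegree (a : multiindex) : nat := (\sum_(i < n) a i)%N.

Definition monomial (K : comNzRingType) (z : 'rV[K]_n) (a : multiindex) : K :=
  \prod_(i < n) z ord0 i ^+ a i.

Definition vpoly (s : seq multiindex) (x : multiindex -> X) :
    'rV[C R]_n -> X :=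
  fun z => \sum_(a <- s) monomial z a *: x a.

(* A map on D is represented by a total function, whose values outside D are
   irrelevant: the notions below only depend on the restriction to D. *)
Definition holomorphic D f : Prop := forall z, D z -> differentiable f z.

Definition Hoo D : set ('rV[C R]_n -> X) :=
  [set f | holomorphic D f /\ bounded_set (f @` D)].

Definition sup_norm D f : \bar R := ereal_sup [set (rnorm (f z))%:E | z in D].

(* f(z) is the unconditional sum of the x_a z^a, that is, the limit of the
   finite partial sums along the finite sets of multi-indices, at every z in D. *)
Definition expansion D f (x : multiindex -> X) : Prop :=
  forall z, D z ->
    summability.partial_sum (fun a => monomial z a *: x a)
      @ summability.totally --> f z.

(* The family of the coefficients x_a(f): on a complete Reinhardt domain the
   expansion of a holomorphic map exists and is unique, so that the default
   value of xget is not reached. *)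
Definition coefs D f : multiindex -> X :=
  xget (fun=> 0) [set x | expansion D f x].

Local Open Scope ereal_scope.

Definition Bohr_ineq D (p q lambda : R) (r : 'rV[R]_n) f : Prop :=
  (rnorm (coefs D f [ffun=> 0%N]) `^ p)%:E
  + (\sum_(1 <= m <oo) \esum_(a in [set a | mdegree a = m])
       (rnorm (coefs D f a) * monomial r a)%:E) `^ q
  <= lambda%:E * sup_norm D f.

(* The supremum is taken in the extended reals; that of the empty set is -oo. *)
Definition Bohr_radius D (p q : R) (F : set ('rV[C R]_n -> X)) (lambda : R) :
    \bar R :=
  ereal_sup [set (n%:R^-1 * \sum_(i < n) r ord0 i)%R%:E | r in
    [set r : 'rV[R]_n | (forall i, (0 <= r ord0 i)%R) /\
                        forall f, F f -> Bohr_ineq D p q lambda r f]].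

End Defs.

Arguments Hoo {R n} X D.

(* Main.v *)
(* Let r be admissible for the polynomials and f bounded by B with expansion
   sum_a x_a z^a. Averaging over the torus gives |x_a z^a| <= B on Omega, so for
   t < 1 the expansion of z |-> f (t z) converges uniformly on Omega, and f (t .)
   is a uniform limit of polynomials g with coefficients t^|a| x_a whose norms
   tend to at most B. Applying the Bohr inequality to g, truncating at degree K
   and letting t -> 1, then K -> oo, yields the inequality for f. Conversely, a
   map of O with finite norm is in Hoo, and for infinite norm the inequality is
   void. *)
Require Import Defs.
From HB Require Import structures.
From mathcomp Require Import all_boot all_order all_algebra.
From mathcomp Require Import finmap.
From mathcomp Require Import all_classical all_reals all_analysis.
From mathcomp Require Import complex lra.
From mathcomp Require summability.
Set Implicit Arguments.
Unset Strict Implicit.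
Unset Printing Implicit Defensive.
Import Order.TTheory GRing.Theory Num.Theory numFieldNormedType.Exports.
Local Open Scope classical_set_scope.
Local Open Scope ring_scope.

(** * Unconditional sums along finite index sets *)

Lemma cvg_totallyP (I : choiceType) (K : numFieldType) (V : normedModType K)
    (c : I -> V) (l : V) :
  summability.partial_sum c @ summability.totally --> l <->
  forall e : K, 0 < e -> exists A : {fset I}, forall B : {fset I},
    (A `<=` B)%fset -> `|l - \sum_(i <- B) c i| < e.
Proof.
have FF : Filter (@summability.totally I).
  exact: (@filter_filter _ _ summability.totally_filter).
split=> [/cvgrPdist_lt h e /h [A _ sA]|h].
  by exists A => B /sA; rewrite /= /summability.partial_sum big_seq_fsetE.
apply/cvgrPdist_lt => e /h [A sA]; exists A => // B /sA.
by rewrite /= /summability.partial_sum big_seq_fsetE.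
Qed.

Lemma big_fset_subset (I : choiceType) (V : nmodType) (A B : {fset I})
    (c : I -> V) : (A `<=` B)%fset ->
  \sum_(i <- B) c i = \sum_(i <- A) c i + \sum_(i <- (B `\` A)%fset) c i.
Proof.
move=> AB; rewrite (big_fsetID _ (mem A))/=; congr (_ + _).
  congr (\sum_(i <- enum_fset _) _); apply/fsetP => i.
  by rewrite !inE/= andbC; case: (boolP (i \in A)) => // /(fsubsetP AB) ->.
congr (\sum_(i <- enum_fset _) _); apply/fsetP => i.
by rewrite !inE/= andbC.
Qed.

(** Cauchy criterion: the partial sums over [A] and over its union with a disjoint [T] both lie
    within [e / 2] of [l], and their difference is the sum over [T]. *)
Lemma totally_cauchy (I : choiceType) (K : numFieldType) (V : normedModType K)
    (c : I -> V) (l : V) (e : K) :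
  summability.partial_sum c @ summability.totally --> l -> 0 < e ->
  exists A : {fset I}, forall T : {fset I},
    [disjoint A & T]%fset -> `|\sum_(i <- T) c i| < e.
Proof.
move=> /cvg_totallyP h e0.
have /h[A sA] : 0 < e / 2 by rewrite divr_gt0.
exists A => T AT.
have := sA _ (fsubsetUl A T).
rewrite (big_fset_subset _ (fsubsetUl A T)) fsetDUl fsetDv fset0U.
rewrite (_ : (T `\` A)%fset = T); last by apply/fsetDidPl; rewrite fdisjoint_sym.
have := sA _ (fsubset_refl A); set u := \sum_(i <- A) c i.
set v := \sum_(i <- T) c i => h1 h2.
have -> : v = (l - u) - (l - (u + v)).
  by rewrite opprB addrC subrKA addrAC subrr add0r.
by rewrite [e]splitr (le_lt_trans (ler_normB _ _))// ltrD.
Qed.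

(** * Orthogonality relations for roots of unity *)

(** The summands are the powers of w = [z ^+ b / z ^+ a], which satisfies w ^ M = 1. Either w = 1,
    which is the congruence, or the geometric sum vanishes because its product with w - 1 is w ^ M -
    1 = 0. *)
Lemma sum_primitive_root (F : fieldType) (M : nat) (z : F) (a b : nat) :
  M.-primitive_root z ->
  \sum_(j < M) z ^+ j ^+ b / z ^+ j ^+ a =
  if b == a %[mod M] then M%:R else 0.
Proof.
move=> zM; have M0 := prim_order_gt0 zM.
have z0 : z != 0.
  apply/eqP => z0; have := prim_expr_order zM.
  by rewrite z0 expr0n gtn_eqF// => /eqP; rewrite eq_sym oner_eq0.
have E j : z ^+ j ^+ b / z ^+ j ^+ a = (z ^+ b / z ^+ a) ^+ j.
  by rewrite -!exprM mulnC (mulnC j) !exprM exprMn exprVn.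
under eq_bigr do rewrite E.
rewrite -(eq_prim_root_expr zM).
have za k : z ^+ k != 0 by rewrite expf_neq0.
rewrite -(inj_eq (mulIf (invr_neq0 (za a)))) divff//.
case: eqP => [->|/eqP w1].
  by under eq_bigr do rewrite expr1n; rewrite sumr_const card_ord.
have := subrX1 (z ^+ b / z ^+ a) M.
rewrite exprMn exprVn -!exprM ![(_ * M)%N]mulnC !exprM (prim_expr_order zM).
rewrite !expr1n divff ?oner_eq0// subrr => /esym/eqP.
by rewrite mulf_eq0 subr_eq0 (negbTE w1) => /eqP.
Qed.

(** Distributivity turns the sum over the grid into a product of one-variable sums, one for each
    coordinate. *)
Lemma sum_torus (F : fieldType) (n M : nat) (z : F) (a b : 'I_n -> nat) :
  M.-primitive_root z ->
  \sum_(j : {ffun 'I_n -> 'I_M}) \prod_i (z ^+ j i ^+ b i / z ^+ j i ^+ a i) =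
  if [forall i, b i == a i %[mod M]] then (M ^ n)%:R else 0.
Proof.
move=> zM.
rewrite -(bigA_distr_bigA (fun i (k : 'I_M) => z ^+ k ^+ b i / z ^+ k ^+ a i)).
under eq_bigr do rewrite (sum_primitive_root _ _ zM).
case: ifPn => [/forallP h|].
  under eq_bigr do rewrite h.
  by rewrite prodr_const card_ord natrX.
by rewrite negb_forall => /existsP[i hi]; rewrite (bigD1 i)//= (negbTE hi) mul0r.
Qed.

Lemma expi_exp (R : realType) (t : R) (k : nat) : expi t ^+ k = expi (t *+ k).
Proof.
elim: k => [|k IH]; first by rewrite expr0 mulr0n /expi cos0 sin0.
rewrite exprS IH mulrS /expi cosD sinD; apply/eqP.
by rewrite eq_complex /= eqxx /= addrC.
Qed.

Lemma norm_expi (R : realType) (t : R) : `|expi t| = 1.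
Proof. by rewrite /expi normc_def /= cos2Dsin2 sqrtr1. Qed.

Lemma expi_primitive_root (R : realType) (M : nat) : (0 < M)%N ->
  M.-primitive_root (expi (2 * pi / M%:R : R)).
Proof.
move=> M0; have M0r : (0 : R) < M%:R by rewrite ltr0n.
apply/andP; split=> //; apply/forallP => i; apply/eqP.
rewrite unity_rootE expi_exp; case: (eqVneq i.+1 M) => [->|iM].
  rewrite -[_ *+ M]mulr_natr divfK ?lt0r_neq0// mulr_natl /expi.
  by rewrite cos2pi sin2pi; apply/eqP.
(* Half-angle argument: cos (2 x) = 1 forces sin x = 0, whereas x = pi (i + 1) / M lies strictly
   between 0 and pi. *)
have -> : 2 * pi / M%:R *+ i.+1 = (pi * (i.+1%:R / M%:R)) *+ 2 :> R.
  by rewrite -[LHS]mulr_natr -[RHS]mulr_natl !mulrA mulrAC.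
apply/negbTE/negP => /eqP /(congr1 (@complex.Re R)) /=.
rewrite cos_mulr2n => h.
have : sin (pi * (i.+1%:R / M%:R)) ^+ 2 = 0 :> R.
  by apply/eqP; rewrite sin2cos2 subr_eq0; apply/eqP; lra.
apply/eqP; rewrite expf_neq0// gt_eqF// sin_gt0_pi// mulr_gt0 ?pi_gt0 ?divr_gt0//=.
by rewrite gtr_pMr ?pi_gt0// ltr_pdivrMr// mul1r ltr_nat ltn_neqAle iM ltn_ord.
Qed.

(** * Boxes of multi-indices and monomials on the torus *)

(** Built as an image of [{ffun 'I_n -> 'I_M}] so that sums over it become sums over that finite
    type, to which distributivity applies. *)
Definition box (n M : nat) : {fset multiindex n} :=
  [fset ([ffun i => val (j i)] : multiindex n) |
    j : {ffun 'I_n -> 'I_M} in predT]%fset.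

Lemma mem_box (n M : nat) (a : multiindex n) :
  (a \in box n M) = [forall i, a i < M]%N.
Proof.
apply/imfsetP/forallP => [[j _ ->] i|h]; first by rewrite ffunE ltn_ord.
exists [ffun i => Ordinal (h i)] => //.
by apply/ffunP => i; rewrite !ffunE.
Qed.

Lemma sub_box (n : nat) (S : {fset multiindex n}) :
  exists2 M, (0 < M)%N & (S `<=` box n M)%fset.
Proof.
exists (\max_(a <- S) \max_i a i).+1 => //; apply/fsubsetP => a aS.
rewrite mem_box; apply/forallP => i; rewrite ltnS.
rewrite (leq_trans (leq_bigmax i))//.
by rewrite (big_fsetD1 a)//= leq_maxl.
Qed.

Lemma sum_box (n M : nat) (V : nmodType) (F : multiindex n -> V) :
  \sum_(a <- box n M) F a =
  \sum_(j : {ffun 'I_n -> 'I_M}) F [ffun i => val (j i)].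
Proof.
rewrite big_imfset/=; first by rewrite big_enum.
move=> j k _ _ /ffunP jk; apply/ffunP => i; apply/val_inj.
by have := jk i; rewrite !ffunE.
Qed.

Lemma monomialM (n : nat) (K : comNzRingType) (u z : 'rV[K]_n)
    (a : multiindex n) :
  monomial (\row_i (u ord0 i * z ord0 i)) a = monomial u a * monomial z a.
Proof.
rewrite /monomial -big_split/=; apply: eq_bigr => i _.
by rewrite mxE exprMn.
Qed.

Lemma monomial_torus (R : realType) (n M : nat) (a b : multiindex n) :
  (0 < M)%N ->
  \sum_(j : {ffun 'I_n -> 'I_M})
    monomial (\row_i expi (2 * pi / M%:R *+ j i : R)) b /
    monomial (\row_i expi (2 * pi / M%:R *+ j i : R)) a =
  if [forall i, b i == a i %[mod M]] then (M ^ n)%:R else 0 :> C R.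
Proof.
move=> M0; rewrite -(sum_torus _ _ (expi_primitive_root R M0)).
apply: eq_bigr => j _; rewrite /monomial -prodf_div; apply: eq_bigr => i _.
by rewrite mxE -expi_exp.
Qed.

Lemma norm_monomial_expi (R : realType) (n : nat) (t : 'I_n -> R)
    (a : multiindex n) : `|monomial (\row_i expi (t i)) a| = 1.
Proof.
rewrite /monomial normr_prod big1// => i _.
by rewrite mxE normrX norm_expi expr1n.
Qed.

(** * Cauchy estimates and uniqueness of expansions on Reinhardt domains *)

(** The rotated point is written in the shape expected by [monomialM], so that its monomials
    split. *)
Lemma Reinhardt_rot (R : realType) (n : nat) (D : set 'rV[C R]_n)
    (z : 'rV[C R]_n) (t : 'I_n -> R) : complete_Reinhardt D -> D z ->
  D (\row_i ((\row_i expi (t i)) ord0 i * z ord0 i)).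
Proof.
move=> [_ h] /h /(_ (fun=> 1) t) H.
rewrite (_ : \row_i _ =
  \row_i ((real_complex R 1 : C R) * expi (t i) * z ord0 i)).
  by apply: H => i; rewrite ler01 lexx.
by apply/rowP => i; rewrite !mxE mul1r.
Qed.

(* Averaging over M-th roots of unity only leaves the indices congruent to a
   modulo M; those other than a avoid any given finite set when M is large, so
   unconditional convergence makes their contribution negligible. *)
Lemma Cauchy_estimate (R : realType) (n : nat) (X : completeNormedModType (C R))
    (D : set 'rV[C R]_n) (f : 'rV[C R]_n -> X) (x : multiindex n -> X)
    (B : C R) (z : 'rV[C R]_n) (a : multiindex n) :
  complete_Reinhardt D -> expansion D f x -> (forall z, D z -> `|f z| <= B) ->
  D z -> `|monomial z a *: x a| <= B.
Proof.
move=> rD fx fB Dz; apply/ler_addgt0Pr => e e0.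
have e20 : 0 < e / 2 by rewrite divr_gt0.
have [A0 hA0] := totally_cauchy (fx z Dz) e20.
(* All exponents of [a] and of the members of [A0] are below [M], so congruence modulo [M] is
   equality among these indices. *)
have [M M0 AM] := sub_box (a |` A0)%fset.
pose u (j : {ffun 'I_n -> 'I_M}) : 'rV[C R]_n :=
  \row_i expi (2 * pi / M%:R *+ j i : R).
pose Z j : 'rV[C R]_n := \row_i (u j ord0 i * z ord0 i).
have DZ j : D (Z j) by exact: Reinhardt_rot.
have /choice[A hA] : forall j, exists A : {fset multiindex n}, forall B,
    (A `<=` B)%fset ->
    `|f (Z j) - \sum_(b <- B) monomial (Z j) b *: x b| < e / 2.
  by move=> j; exact: (cvg_totallyP _ _).1 (fx _ (DZ j)) _ e20.
(* A single finite set that serves all the rotated points at once. *)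
pose S := (a |` A0 `|` \bigcup_(j <- enum {ffun 'I_n -> 'I_M}) A j)%fset.
have AS j : (A j `<=` S)%fset.
  by rewrite fsubsetU// (bigfcup_sup A)// ?orbT// mem_enum.
have bS j : `|\sum_(b <- S) monomial (Z j) b *: x b| <= B + e / 2.
  rewrite -[X in `|X|](subKr (f (Z j))) (le_trans (ler_normB _ _))//.
  by rewrite lerD ?fB// ltW// hA.
have c0 j b : monomial (u j) b != 0.
  by rewrite -normr_eq0 norm_monomial_expi oner_eq0.
(* Up to the factor [M ^ n], the average of the rotated partial sums against the inverse character
   of [a]. It is bounded termwise by [Wle] and computed by orthogonality in [WE]. *)
pose W := \sum_j (monomial (u j) a)^-1 *:
  \sum_(b <- S) monomial (Z j) b *: x b.
have Wle : `|W| <= (M ^ n)%:R * (B + e / 2).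
  rewrite (le_trans (ler_norm_sum _ _ _))//.
  rewrite (@le_trans _ _ (\sum_(j : {ffun 'I_n -> 'I_M}) (B + e / 2)))//.
    apply: ler_sum => j _.
    by rewrite normrZ normfV norm_monomial_expi invr1 mul1r.
  by rewrite sumr_const card_ffun !card_ord mulr_natl.
pose P (b : multiindex n) := [forall i, b i == a i %[mod M]].
have WE : W = (M ^ n)%:R *: \sum_(b <- S | P b) monomial z b *: x b.
  rewrite /W; under eq_bigr do rewrite scaler_sumr.
  rewrite exchange_big/= scaler_sumr [RHS]big_mkcond/=; apply: eq_bigr => b _.
  under eq_bigr do rewrite monomialM !scalerA mulrA (mulrC _^-1).
  rewrite -scaler_suml -mulr_suml monomial_torus// -/(P b).
  by case: (P b); rewrite ?mul0r ?scale0r// scalerA.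
have aS : a \in S by rewrite !inE eqxx.
have Mn0 : 0 < (M ^ n)%:R :> C R by rewrite ltr0n expn_gt0 M0.
move: Wle; rewrite WE normrZ normr_nat ler_pM2l// => Wle.
rewrite (big_fset_condE _ S P) in Wle.
have aP : a \in [fset b in S | P b]%fset.
  by rewrite !inE eqxx/=; apply/forallP.
move: Wle; rewrite (big_fsetD1 a)//=; set T := (_ `\ a)%fset.
(* A member of [A0] congruent to [a] modulo [M] equals [a], which [T] omits; hence the sum over [T]
   is below [e / 2]. *)
have /hA0 : [disjoint A0 & T]%fset.
  apply/fdisjointP => b bA0; rewrite !inE negb_and negbK.
  case: (eqVneq b a) => //= ba; rewrite negb_and.
  apply/orP; right; apply: contra ba => /forallP h; apply/eqP/ffunP => i.
  have lt c : c \in (a |` A0)%fset -> (c i < M)%N.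
    by move=> /(fsubsetP AM); rewrite mem_box => /forallP.
  by have /eqP := h i; rewrite !modn_small// lt// !inE ?eqxx ?bA0 ?orbT.
set v := \sum_(i <- T) _ => ve ave.
rewrite -[X in `|X|](addrK v) (le_trans (ler_normB _ _))//.
by rewrite [e in leRHS]splitr addrA lerD// ltW.
Qed.

Lemma Reinhardt_scale (R : realType) (n : nat) (D : set 'rV[C R]_n)
    (z : 'rV[C R]_n) (r : R) : complete_Reinhardt D -> D z -> 0 <= r <= 1 ->
  D (\row_i ((const_mx (r%:C%C : C R) : 'rV[C R]_n) ord0 i * z ord0 i)).
Proof.
move=> [_ h] /h /(_ (fun=> r) (fun=> 0)) H r01.
rewrite (_ : \row_i _ =
  \row_i ((real_complex R r : C R) * expi 0 * z ord0 i)); first exact: H.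
apply/rowP => i; rewrite !mxE; congr (_ * _).
by rewrite /expi cos0 sin0; exact/esym/mulr1.
Qed.

Lemma monomial_const (n : nat) (K : comNzRingType) (c : K) (a : multiindex n) :
  monomial (const_mx c) a = c ^+ mdegree a.
Proof.
by rewrite /monomial -prodrXr; apply: eq_bigr => i _; rewrite mxE.
Qed.

(** Scaling by 0 puts the origin in [D], and [D] is open, so it contains a constant vector with
    small positive entries. At such a point each coefficient can be read off its term. *)
Lemma Reinhardt_monomial_neq0 (R : realType) (n : nat) (D : set 'rV[C R]_n) :
  complete_Reinhardt D ->
  exists2 z, D z & forall a : multiindex n, monomial z a != 0.
Proof.
move=> rD; have [[[z Dz] oD _] _] := rD.
have D0 : D 0.
  have := Reinhardt_scale rD Dz (r := 0); rewrite lexx ler01 => /(_ isT).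
  congr D; apply/rowP => i; rewrite !mxE; exact: mul0r.
have /nbhs_ballP[e /= e0 De] : nbhs (0 : 'rV[C R]_n) D by exact: open_nbhs_nbhs.
have e20 : 0 < e / 2 by rewrite divr_gt0.
exists (const_mx (e / 2)).
  apply: De; split=> // i j; rewrite !mxE -ball_normE /ball_/= sub0r normrN gtr0_norm//.
  by rewrite ltr_pdivrMr// ltr_pMr// ltr1n.
by move=> a; rewrite monomial_const expf_neq0// gt_eqF.
Qed.

(** The difference of two expansions expands the zero map, so the Cauchy estimate with bound 0 kills
    each of its terms; a point where no monomial vanishes then gives the coefficients. *)
Lemma expansion_unique (R : realType) (n : nat) (X : completeNormedModType (C R))
    (D : set 'rV[C R]_n) (f : 'rV[C R]_n -> X) (x y : multiindex n -> X) :
  complete_Reinhardt D -> expansion D f x -> expansion D f y -> x = y.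
Proof.
move=> rD fx fy; have [z Dz z0] := Reinhardt_monomial_neq0 rD.
have xy : expansion D (fun=> 0) (fun a => x a - y a).
  move=> w Dw; rewrite -[X in _ --> X](subrr (f w)).
  have FF : Filter (@summability.totally (multiindex n)).
    exact: (@filter_filter _ _ summability.totally_filter).
  rewrite (_ : summability.partial_sum _ =
      summability.partial_sum (fun a => monomial w a *: x a) \-
      summability.partial_sum (fun a => monomial w a *: y a)).
    exact: cvgB (fx w Dw) (fy w Dw).
  apply/funext => A; rewrite /summability.partial_sum /= -sumrB.
  by apply: eq_bigr => i _; rewrite scalerBr.
apply/funext => a; apply/eqP; rewrite -subr_eq0.
have : `|monomial z a *: (x a - y a)| <= 0.
  apply: (Cauchy_estimate a rD xy) Dz => w _.
  by rewrite normr0.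
by rewrite normr_le0 scaler_eq0 (negbTE (z0 a)).
Qed.

Lemma coefs_expansion (R : realType) (n : nat) (X : completeNormedModType (C R))
    (D : set 'rV[C R]_n) (f : 'rV[C R]_n -> X) (x : multiindex n -> X) :
  complete_Reinhardt D -> expansion D f x -> coefs D f = x.
Proof.
move=> rD fx; apply: xget_unique => // y fy.
exact: expansion_unique rD fy fx.
Qed.

(** The indices form an [{fset}], without repetition; in a sequence, repeated indices would multiply
    the coefficients. *)
Lemma expansion_vpoly (R : realType) (n : nat) (X : completeNormedModType (C R))
    (D : set 'rV[C R]_n) (f : 'rV[C R]_n -> X) (s : {fset multiindex n})
    (x : multiindex n -> X) :
  {in D, f =1 vpoly s x} ->
  expansion D f (fun a => if a \in s then x a else 0).
Proof.
move=> fs z Dz; apply/cvg_totallyP => e e0; exists s => B sB.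
rewrite fs ?inE// /vpoly (big_fset_subset _ sB).
rewrite [X in _ - (X + _)](_ : _ = \sum_(a <- s) monomial z a *: x a).
  by rewrite opprD addrA subrr sub0r normrN big1_seq ?normr0// => a /=;
    rewrite !inE => /andP[/negbTE -> _]; rewrite scaler0.
by rewrite big_seq [RHS]big_seq; apply: eq_bigr => a ->.
Qed.

(** * Polynomial approximation of dilated maps *)

(** The sum over the box factors into [n] geometric sums, each at most 1 / (1 - r). *)
Lemma sum_geometric_box (R : realType) (n M : nat) (r : R) : 0 <= r < 1 ->
  \sum_(a <- box n M) r ^+ mdegree a <= (1 - r)^-1 ^+ n.
Proof.
move=> /andP[r0 r1]; rewrite sum_box.
under eq_bigr do rewrite /mdegree -prodrXr.
rewrite (eq_bigr (fun j : {ffun 'I_n -> 'I_M} => \prod_i r ^+ j i)); last first.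
  by move=> j _; apply: eq_bigr => i _; rewrite ffunE.
rewrite -(bigA_distr_bigA (fun i (k : 'I_M) => r ^+ k)) prodr_const card_ord.
rewrite lerXn2r// ?nnegrE ?sumr_ge0 ?invr_ge0 ?subr_ge0 ?(ltW r1)//.
  by move=> i _; rewrite exprn_ge0.
rewrite -[leRHS]mul1r ler_pdivlMr ?subr_gt0//.
have := subrX1 r M; have := exprn_ge0 M r0.
set u := r ^+ M; set v := \sum_(_ < _) _; nra.
Qed.

(** Boxes bound all the finite sums, so these have a supremum. Once a finite set comes within [e] of
    it, any disjoint set can add at most [e]. *)
Lemma geometric_tail (R : realType) (n : nat) (r e : R)
    (s0 : {fset multiindex n}) : 0 <= r < 1 -> 0 < e ->
  exists2 s : {fset multiindex n}, (s0 `<=` s)%fset &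
    forall T : {fset multiindex n}, [disjoint s & T]%fset ->
      \sum_(a <- T) r ^+ mdegree a <= e.
Proof.
move=> r01 e0; have r0 : 0 <= r by case/andP: r01.
pose w (S : {fset multiindex n}) := \sum_(a <- S) r ^+ mdegree a.
have wle S S' : (S `<=` S')%fset -> w S <= w S'.
  move=> SS'; rewrite /w (big_fset_subset _ SS') lerDl.
  by apply: sumr_ge0 => a _; rewrite exprn_ge0.
have wB S : w S <= (1 - r)^-1 ^+ n.
  have [M _ /wle/le_trans] := sub_box S; apply.
  exact: sum_geometric_box.
have hs : has_sup (range w).
  split; first by exists (w fset0); exists fset0.
  by exists ((1 - r)^-1 ^+ n) => _ [S _ <-].
have [_ [S _ <-] hS] := sup_adherent e0 hs.
exists (s0 `|` S)%fset; first exact: fsubsetUl.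
move=> T sT; have : w (s0 `|` S `|` T)%fset <= sup (range w).
  by apply: ub_le_sup; [case: hs|exists (s0 `|` S `|` T)%fset].
have := wle _ _ (fsubsetUr s0 S).
rewrite /w (big_fset_subset _ (fsubsetUl _ T)) fsetDUl fsetDv fset0U.
rewrite (_ : (T `\` _)%fset = T).
  by move: hS; rewrite /w; lra.
by apply/fsetDidPl; rewrite fdisjoint_sym.
Qed.

(** Truncates the expansion of the dilate of [f] by [r]. The Cauchy estimate at [z] bounds each
    discarded term by B r ^ |a|, so the remainder is at most [B * e] uniformly in [z]. The
    prescribed [s0] allows chosen coefficients to be kept. *)
Lemma vpoly_approx (R : realType) (n : nat) (X : completeNormedModType (C R))
    (D : set 'rV[C R]_n) (f : 'rV[C R]_n -> X) (x : multiindex n -> X)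
    (B r e : R) (s0 : {fset multiindex n}) :
  complete_Reinhardt D -> expansion D f x ->
  (forall z, D z -> `|f z| <= B%:C%C) -> 0 <= r < 1 -> 0 < e ->
  exists2 s : {fset multiindex n}, (s0 `<=` s)%fset &
    forall z, D z ->
      `|vpoly s (fun a => (r ^+ mdegree a)%:C%C *: x a) z| <=
      (B * (1 + e))%:C%C.
Proof.
move=> rD fx fB r01 e0; have [s s0s hs] := geometric_tail s0 r01 e0.
exists s => // z Dz; apply/ler_addgt0Pr => d d0.
have r01' : 0 <= r <= 1 by case/andP: r01 => -> /ltW.
pose z' : 'rV[C R]_n :=
  \row_i ((const_mx (r%:C%C : C R) : 'rV[C R]_n) ord0 i * z ord0 i).
have Dz' : D z' by exact: Reinhardt_scale.
have mz' a : monomial z' a *: x a = (r ^+ mdegree a)%:C%C *: (monomial z a *: x a).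
  by rewrite monomialM monomial_const -scalerA rmorphXn.
have [A hA] := (cvg_totallyP _ _).1 (fx z' Dz') _ d0.
have := hA _ (fsubsetUr s A); rewrite (big_fset_subset _ (fsubsetUl s A)).
have -> : \sum_(a <- s) monomial z' a *: x a =
    vpoly s (fun a => (r ^+ mdegree a)%:C%C *: x a) z.
  by apply: eq_bigr => a _; rewrite mz' !scalerA mulrC.
set g := vpoly _ _ _; set T := (_ `\` _)%fset.
have : `|\sum_(a <- T) monomial z' a *: x a| <= (B * e)%:C%C.
  have B0 : 0 <= B by rewrite -lecR (le_trans _ (fB _ Dz)).
  apply: (@le_trans _ _ ((B * \sum_(a <- T) r ^+ mdegree a)%:C%C)); last first.
    rewrite lecR ler_wpM2l// hs//; apply/fdisjointP => a as_.
    by rewrite inE as_.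
  rewrite (le_trans (ler_norm_sum _ _ _))// rmorphM rmorph_sum mulr_sumr.
  apply: ler_sum => a _; rewrite mz' normrZ mulrC.
  rewrite ler_pM ?(Cauchy_estimate a rD fx fB)//.
  by rewrite ger0_norm// lecR exprn_ge0//; case/andP: r01.
set v := \sum_(a <- T) _ => hv hg.
(* The three pieces are a value of [f], the error [d] of a finite partial sum at [z'], and the
   discarded terms [v]. *)
have -> : g = f z' - (f z' - (g + v)) - v.
  by rewrite subKr addrK.
rewrite (le_trans (ler_normB _ _))// mulrDr mulr1 rmorphD/= addrAC lerD//.
by rewrite (le_trans (ler_normB _ _))// lerD ?fB// ltW.
Qed.

(** * Scaling of sums and limits of powers *)

Lemma esum_scale_le (R : realType) (I : choiceType) (S : set I)
    (f g : I -> \bar R) (r : R) : 0 < r -> (forall a, 0 <= f a)%E ->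
  (forall a, S a -> r%:E * f a <= g a)%E ->
  (r%:E * (\esum_(a in S) f a) <= \esum_(a in S) g a)%E.
Proof.
move=> r0 f0 fg; rewrite muleC -lee_pdivlMr//; apply: ge_ereal_sup => _ [F FS <-].
rewrite lee_pdivlMr// muleC ge0_mule_fsumr//; apply: esum_ge; exists F => //.
by apply: lee_fsum; [case: FS|move=> a Fa; apply: fg; case: FS => _; exact].
Qed.

(** For a fixed factor [s] in front of the power, [e] tends to 0; then [s] tends to 1. *)
Lemma powR_limit (R : realType) (A c t q : R) (K : nat) :
  (0 < K)%N -> 0 <= c -> 0 <= t -> 1 <= q ->
  (forall r e, 0 < r < 1 -> 0 < e -> A + (r ^+ K * t) `^ q <= c * (1 + e)) ->
  A + t `^ q <= c.
Proof.
move=> K0 c0 t0 q1 h; have q0 : 0 < q by exact: lt_le_trans q1.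
have Kr : (0 : R) < K%:R by rewrite ltr0n.
have h1 s : 0 < s < 1 -> A + s * t `^ q <= c.
  move=> /andP[s0 s1]; apply/ler_addgt0Pr => e e0.
  have c1 : 0 < c + 1 by rewrite ltr_wpDl.
  (* Chosen so that (r ^ K) ^ q = s. *)
  pose r := s `^ (K%:R * q)^-1.
  have r01 : 0 < r < 1.
    have -> : 1 = 1 `^ (K%:R * q)^-1 :> R by rewrite powR1.
    rewrite powR_gt0//= gt0_ltr_powR ?invr_gt0 ?mulr_gt0// ?nnegrE//.
    exact: ltW.
  (* Dividing by [c + 1] keeps the error c e / (c + 1) at most [e], even when [c] is 0. *)
  have := h r (e / (c + 1)) r01 (divr_gt0 e0 c1).
  rewrite powRM ?exprn_ge0 ?powR_ge0//.
  rewrite -powR_mulrn ?powR_ge0// -!powRrM mulVf ?mulf_neq0 ?gt_eqF//.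
  rewrite powRr1 ?(ltW s0)// mulrDr mulr1 => /le_trans; apply.
  by rewrite lerD2l mulrCA ger_pMr// ler_pdivrMr// mul1r lerDl.
apply/ler_addgt0Pr => d d0; set u := t `^ q in h1 *.
have u0 : 0 <= u by exact: powR_ge0.
have ud0 : 0 < u + d + 1 by rewrite ltr_wpDl// addr_ge0// ltW.
(* This value of [s] lies strictly between 0 and 1, and the loss (1 - s) u is at most [d]. *)
have := h1 (1 - d / (u + d + 1)).
rewrite subr_gt0 gtrBl divr_gt0// ltr_pdivrMr// mul1r.
have -> : d < u + d + 1 by lra.
move=> /(_ isT); rewrite mulrBl mul1r.
have : d / (u + d + 1) * u <= d.
  by rewrite mulrAC -mulrA ger_pMr// ler_pdivrMr// mul1r; lra.
lra.
Qed.

(** * The real-valued norm and the supremum norm *)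

Lemma normE (R : realType) (X : completeNormedModType (C R)) (v : X) :
  `|v| = (rnorm v)%:C%C :> R[i].
Proof. by rewrite /rnorm RRe_real// ger0_real// normr_ge0. Qed.

Lemma rnorm_ge0 (R : realType) (X : completeNormedModType (C R)) (v : X) :
  0 <= rnorm v.
Proof. by rewrite -lecR -normE normr_ge0. Qed.

Lemma rnorm0 (R : realType) (X : completeNormedModType (C R)) :
  rnorm (0 : X) = 0.
Proof. by rewrite /rnorm normr0. Qed.

Lemma rnormZ (R : realType) (X : completeNormedModType (C R)) (r : R) (v : X) :
  0 <= r -> rnorm ((r%:C%C : C R) *: v) = r * rnorm v.
Proof.
move=> r0; have : (rnorm ((r%:C%C : C R) *: v))%:C%C = (r * rnorm v)%:C%C.
  by rewrite -normE normrZ rmorphM /= -normE ger0_norm// lecR.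
by case.
Qed.

(** Covers the maps for which [coefs] takes its default value. The powers of 0 vanish because the
    exponents are nonzero, and a point of [D] makes the supremum norm nonnegative. *)
Lemma Bohr_ineq_coefs0 (R : realType) (n : nat)
    (X : completeNormedModType (C R)) (D : set 'rV[C R]_n) (p q lambda : R)
    (r : 'rV[R]_n) (f : 'rV[C R]_n -> X) :
  D !=set0 -> 0 <= lambda -> p != 0 -> q != 0 -> coefs D f = (fun=> 0) ->
  Bohr_ineq D p q lambda r f.
Proof.
move=> [z Dz] l0 p0 q0 f0; rewrite /Bohr_ineq f0 rnorm0 powR0// add0e.
rewrite eseries0 => [|m _ _].
  rewrite poweRE (negbTE q0)/= powR0// mule_ge0 ?lee_fin//.
  apply: (@le_trans _ _ (rnorm (f z))%:E); first by rewrite lee_fin rnorm_ge0.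
  by apply: ereal_sup_ubound; exists z.
by apply: esum1 => a _; rewrite mul0r.
Qed.

Lemma sup_norm_Hoo (R : realType) (n : nat) (X : completeNormedModType (C R))
    (D : set 'rV[C R]_n) (f : 'rV[C R]_n -> X) :
  D !=set0 -> bounded_set (f @` D) ->
  exists2 B : R, 0 <= B & sup_norm D f = B%:E /\
    forall z, D z -> `|f z| <= B%:C%C.
Proof.
move=> [z0 Dz0] [M [Mr hM]].
(* [bounded_set] gives a bound at every value above [M], in particular at [M + 1]. *)
have fM z : D z -> rnorm (f z) <= complex.Re (M + 1).
  move=> Dz; rewrite -lecR -normE RRe_real ?rpredD ?rpred1//.
  by apply: hM; [rewrite ltrDl|exists z].
have s_ub : (sup_norm D f <= (complex.Re (M + 1))%:E)%E.
  by apply: ge_ereal_sup => _ [z Dz <-]; rewrite lee_fin fM.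
have s_lb z : D z -> ((rnorm (f z))%:E <= sup_norm D f)%E.
  by move=> Dz; apply: ereal_sup_ubound; exists z.
have sfin : sup_norm D f \is a fin_num.
  rewrite ge0_fin_numE; first exact: le_lt_trans s_ub (ltry _).
  by rewrite (le_trans _ (s_lb _ Dz0))// lee_fin rnorm_ge0.
exists (fine (sup_norm D f)).
  by rewrite fine_ge0// (le_trans _ (s_lb _ Dz0))// lee_fin rnorm_ge0.
split; first by rewrite fineK.
by move=> z Dz; rewrite normE lecR -lee_fin fineK// s_lb.
Qed.

Lemma sup_norm_le (R : realType) (n : nat) (X : completeNormedModType (C R))
    (D : set 'rV[C R]_n) (f : 'rV[C R]_n -> X) (B : R) :
  (forall z, D z -> `|f z| <= B%:C%C) -> (sup_norm D f <= B%:E)%E.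
Proof.
by move=> fB; apply: ge_ereal_sup => _ [z Dz <-]; rewrite lee_fin -lecR -normE fB.
Qed.

Lemma monomial_ge0 (R : realType) (n : nat) (r : 'rV[R]_n) (a : multiindex n) :
  (forall i, 0 <= r ord0 i) -> 0 <= monomial r a.
Proof. by move=> r0; apply: prodr_ge0 => i _; rewrite exprn_ge0. Qed.

(** * Transfer of the Bohr inequality to bounded maps *)

Lemma Bohr_ineq_Hoo (R : realType) (n : nat) (X : completeNormedModType (C R))
    (D : set 'rV[C R]_n) (lambda p q : R) (r : 'rV[R]_n)
    (O : set ('rV[C R]_n -> X)) (f : 'rV[C R]_n -> X) :
  complete_Reinhardt D -> 0 <= lambda ->
  (forall (s : seq (multiindex n)) (x : multiindex n -> X),
    exists2 f, O f & {in D, f =1 vpoly s x}) ->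
  1 <= p -> 1 <= q -> (forall i, 0 <= r ord0 i) ->
  (forall g, O g -> Bohr_ineq D p q lambda r g) ->
  Hoo X D f -> Bohr_ineq D p q lambda r f.
Proof.
move=> rD l0 polyO p1 q1 r0 OB [_ fb].
have p0 : p != 0 by rewrite gt_eqF// (lt_le_trans _ p1).
have q0 : 0 < q by rewrite (lt_le_trans _ q1).
have [[Dn0 _ _] _] := rD.
(* Without an expansion, coefs D f is the default value 0. *)
have [[x fx]|nex] := pselect (exists x, expansion D f x); last first.
  apply: Bohr_ineq_coefs0 => //; first by rewrite gt_eqF.
  by rewrite /coefs; case: xgetP => // x _ fx; case: nex; exists x.
have [B B0 [sB fB]] := sup_norm_Hoo Dn0 fb.
pose c0 := rnorm (x [ffun=> 0%N]) `^ p.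
pose u m := \esum_(a in [set a : multiindex n | mdegree a = m])
  (rnorm (x a) * monomial r a)%:E.
rewrite /Bohr_ineq (coefs_expansion rD fx) sB.
change (c0%:E + (\sum_(1 <= m <oo) u m) `^ q <= (lambda * B)%:E)%E.
have u0 m : (0 <= u m)%E.
  by apply: esum_ge0 => a _; rewrite lee_fin mulr_ge0 ?rnorm_ge0 ?monomial_ge0.
(* In degrees up to [K], the dilation factor t ^ |a| is at least [t ^+ K], a single factor that can
   be sent to 1. *)
have partial K : (0 < K)%N ->
    (c0%:E + (\sum_(1 <= m < K.+1) u m) `^ q <= (lambda * B)%:E)%E.
  move=> K0; set U := (\sum_(1 <= m < K.+1) u m)%E.
  have U0 : (0 <= U)%E by exact: sume_ge0.
  have h t e : 0 < t < 1 -> 0 < e ->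
      (c0%:E + ((t ^+ K)%:E * U) `^ q <= (lambda * B * (1 + e))%:E)%E.
    move=> t01 e0; have /andP[t0 t1] := t01.
    have t01' : 0 <= t < 1 by rewrite ltW.
    (* The box with exponents up to [K] contains every index of degree at most [K], so the
       polynomial keeps all the coefficients that enter [U]. *)
    have [s bs hs] := vpoly_approx (box n K.+1) rD fx fB t01' e0.
    have in_s (a : multiindex n) : (mdegree a <= K)%N -> a \in s.
      move=> aK; apply: (fsubsetP bs); rewrite mem_box; apply/forallP => i.
      by rewrite ltnS (leq_trans _ aK)// /mdegree (bigD1 i)//= leq_addr.
    pose y a : X := ((t ^+ mdegree a)%:C%C : C R) *: x a.
    have [g Og gE] := polyO s y.
    have := OB g Og; rewrite /Bohr_ineq.
    rewrite (coefs_expansion rD (expansion_vpoly gE)).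
    (* The constant term has degree 0: dilation leaves it unchanged, and the inequality for [g]
       starts with the same [c0]. *)
    have m0 : mdegree ([ffun=> 0%N] : multiindex n) = 0%N.
      by rewrite /mdegree big1// => i _; rewrite ffunE.
    rewrite in_s ?m0// /y m0 scale1r -/c0 => H.
    apply: (@le_trans _ _ (lambda%:E * sup_norm D g)%E); last first.
      rewrite -mulrA EFinM lee_wpmul2l ?lee_fin//.
      by apply: sup_norm_le => z Dz; rewrite gE ?inE// hs.
    apply: le_trans H; rewrite leeD2l//; set G := (X in (_ <= X `^ _)%E).
    have UG : ((t ^+ K)%:E * U <= G)%E.
      have G0 m : (1 <= m)%N -> true -> (0 <= \esum_(a in [set a | mdegree a = m])
         (rnorm (if a \in s then y a else 0) * monomial r a)%:E)%E.
        move=> _ _; apply: esum_ge0 => a _.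
        by rewrite lee_fin mulr_ge0 ?rnorm_ge0 ?monomial_ge0.
      apply: le_trans (nneseries_lim_ge K.+1 G0).
      rewrite /U ge0_sume_distrr//.
      rewrite big_nat_cond [leRHS]big_nat_cond; apply: lee_sum => m.
      rewrite andbT => /andP[m1 mK]; apply: esum_scale_le.
      - by rewrite exprn_gt0.
      - by move=> a; rewrite lee_fin mulr_ge0 ?rnorm_ge0 ?monomial_ge0.
      move=> a am; rewrite in_s ?am// /y rnormZ ?exprn_ge0 ?(ltW t0)//.
      rewrite -EFinM lee_fin mulrA ler_wpM2r ?monomial_ge0// am.
      by rewrite ler_wpM2r ?rnorm_ge0// ler_wiXn2l// ltW.
    have tU0 : (0 <= (t ^+ K)%:E * U)%E.
      by rewrite mule_ge0// lee_fin exprn_ge0// ltW.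
    apply: gt0_ler_poweR => //; first exact: ltW.
      by rewrite in_itv/= tU0 leey.
    by rewrite in_itv/= (le_trans tU0 UG) leey.
  move: U U0 h => [U| |] // U0 h.
    rewrite poweR_EFin -EFinD lee_fin; apply: (powR_limit K0) => //.
    by rewrite mulr_ge0.
  (* An infinite [U] is impossible: t = 1/2 and e = 1 would already bound +oo by a real number. *)
  have := h 2^-1 1; rewrite invr_gt0 ltr0n invf_lt1 ?ltr1n// ltr01.
  move=> /(_ isT isT); rewrite gt0_muley ?lte_fin ?exprn_gt0 ?invr_gt0//.
  by rewrite poweRyr ?gt_eqF.
have c0ge0 : 0 <= c0 by exact: powR_ge0.
(* What the constant term leaves of the right-hand side. Its [q]-th root bounds all partial sums, so
   the limit is taken before raising to the power [q]. *)
pose d := lambda * B - c0.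
have sum_le K : (\sum_(1 <= m < K) u m <= (d `^ q^-1)%:E)%E.
  (* [partial] asks for a positive degree; enlarging the range to [K.+2] makes it apply for every
     [K], including 0. *)
  apply: (@le_trans _ _ (\sum_(1 <= m < K.+2) u m)%E).
    by apply: lee_sum_nneg_natr => //; rewrite -addn2 leq_addr.
  have := partial K.+1 isT; set V := (\sum_(_ <= _ < _) _)%E.
  have : (0 <= V)%E by exact: sume_ge0.
  case: V => [v| |]//; last by rewrite poweRyr ?gt_eqF.
  rewrite poweR_EFin -EFinD !lee_fin => v0 h; rewrite -[leLHS]powRr1// -(@divff _ q) ?gt_eqF//.
  rewrite powRrM ge0_ler_powR ?invr_ge0 ?(ltW q0)// ?nnegrE ?powR_ge0//.
    by rewrite /d; move: h (powR_ge0 v q); lra.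
  by rewrite /d; lra.
have lim_le : (\sum_(1 <= m <oo) u m <= (d `^ q^-1)%:E)%E.
  apply: lime_le; first exact: is_cvg_nneseries.
  exact: nearW.
have d0 : 0 <= d.
  have := partial 1 isT; rewrite /d subr_ge0 -lee_fin; apply: le_trans.
  by rewrite leeDl// poweR_ge0.
have -> : lambda * B = c0 + d by rewrite /d subrKC.
rewrite EFinD leeD2l//.
have -> : d%:E = (((d `^ q^-1)%:E) `^ q)%E.
  by rewrite poweR_EFin -powRrM mulVf ?gt_eqF// powRr1.
have s0 : (0 <= \sum_(1 <= m <oo) u m)%E by exact: nneseries_ge0.
by apply: gt0_ler_poweR; rewrite ?in_itv/= ?(ltW q0) ?s0 ?leey ?lee_fin ?powR_ge0.
Qed.

Lemma sup_norm_lty_bounded (R : realType) (n : nat)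
    (X : completeNormedModType (C R)) (D : set 'rV[C R]_n)
    (f : 'rV[C R]_n -> X) :
  (sup_norm D f < +oo)%E -> bounded_set (f @` D).
Proof.
move=> flt; have fb z : D z -> `|f z| <= (fine (sup_norm D f))%:C%C.
  move=> Dz; have h : ((rnorm (f z))%:E <= sup_norm D f)%E.
    by apply: ereal_sup_ubound; exists z.
  rewrite normE lecR -lee_fin fineK// ge0_fin_numE// (le_trans _ h)//.
  by rewrite lee_fin rnorm_ge0.
exists (fine (sup_norm D f))%:C%C; split; first by rewrite complex_real.
by move=> M /ltW lM _ [z Dz <-]; exact: le_trans (fb _ Dz) lM.
Qed.

Theorem theorem2p4 (R : realType) (n : nat) (X : completeNormedModType (C R))
    (Omega : set 'rV[C R]_n) (lambda p q : R)
    (O : set ('rV[C R]_n -> X)) :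
  (0 < n)%N ->
  complete_Reinhardt Omega ->
  1 <= lambda ->
  GRing.submod_closed (mem O) ->
  (forall f, O f -> holomorphic Omega f) ->
  (forall (s : seq (multiindex n)) (x : multiindex n -> X),
    exists2 f, O f & {in Omega, f =1 vpoly s x}) ->
  1 <= p -> 1 <= q ->
  Bohr_radius Omega p q O lambda = Bohr_radius Omega p q (Hoo X Omega) lambda.
Proof.
move=> _ rD l1 _ Ohol polyO p1 q1.
have l0 : 0 < lambda by exact: lt_le_trans l1.
(* The two sets of admissible radii are equal, not only their suprema. *)
rewrite /Bohr_radius; congr (ereal_sup (_ @` _)); apply/seteqP.
split=> r [r0 B]; split=> // f Ff.
  exact: (Bohr_ineq_Hoo rD (ltW l0) polyO p1 q1 r0 B Ff).
have [flt|] := ltP (sup_norm Omega f) +oo%E.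
  by apply: B; split; [exact: Ohol|exact: sup_norm_lty_bounded].
by rewrite leye_eq /Bohr_ineq => /eqP ->; rewrite gt0_muley ?lte_fin ?leey.
Qed.
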